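(* Let $\varphi\colon\mathbb{R}^n\to\overline{\mathbb{R}}$ be a lower semicontinuous function, and fix $\bar x\in\mathbb{R}^n$ such that $|\varphi(\bar x)|<\infty$. Then the following assertions hold. (a) Pick $u\in\mathcal{C}_\varphi(\bar x)\cap\mathbb{S}$. If $\mathrm{d}^2\varphi(\bar x;0)(u)>0$, then the second-order growth condition holds for $\varphi$ in direction $u$ at $\bar x$. Particularly, $\bar x$ is a strict local minimizer of $\varphi$ in direction $u$. (b) If $\mathrm{d}^2\varphi(\bar x;0)(u)>0$ for all $u\in\mathcal{C}_\varphi(\bar x)\cap\mathbb{S}$, then the second-order growth condition holds for $\varphi$ at $\bar x$. Particularly, $\bar x$ is a strict local minimizer of $\varphi$.
   Context: $\overline{\mathbb{R}}:=\mathbb{R}\cup\{-\infty,\infty\}$; $\mathbb{R}^n$ carries the Euclidean norm $\|\cdot\|$ and inner product $\langle\cdot,\cdot\rangle$; $\mathbb{S}:=\{u\in\mathbb{R}^n : \|u\|=1\}$. Directional neighborhoods: for $\varepsilon,\rho>0$ and $u\in\mathbb{R}^n$, $\mathbb{B}_{\varepsilon,\rho}(u):=\{w\in\mathbb{R}^n : \|w\|\le\varepsilon,\ \big\|\|w\|u-\|u\|w\big\|\le\rho\|u\|\|w\|\}$; note $\mathbb{B}_{\varepsilon,\rho}(0)$ is the closed ball of radius $\varepsilon$ around $0$. Strict directional local minimality: $\bar x$ is a strict local minimizer of $\varphi$ in direction $u$ if there are $\varepsilon,\rho>0$ with $\varphi(x)>\varphi(\bar x)$ for all $x\in\bar x+\mathbb{B}_{\varepsilon,\rho}(u)$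 with $x\ne\bar x$. A strict local minimizer is meant in the usual sense (equivalently, $u=0$). Second-order growth condition: it holds for $\varphi$ in direction $u\in\mathbb{R}^n$ at $\bar x$ if there are $\varepsilon,\rho,\kappa>0$ with $\varphi(x)\ge\varphi(\bar x)+\kappa\|x-\bar x\|^2$ for all $x\in\bar x+\mathbb{B}_{\varepsilon,\rho}(u)$. It holds for $\varphi$ at $\bar x$ if this is true for $u:=0$. First subderivative: $\mathrm{d}\varphi(\bar x)(u):=\liminf_{t\downarrow0,\,u'\to u}\frac{\varphi(\bar x+tu')-\varphi(\bar x)}{t}$. Critical cone: $\mathcal{C}_\varphi(\bar x):=\{u\in\mathbb{R}^n : \mathrm{d}\varphi(\bar x)(u)\le0\}$. Second subderivative at $\bar x$ for $x^*\in\mathbb{R}^n$: $\mathrm{d}^2\varphi(\bar x;x^* )(u):=\liminf_{t\downarrow0,\,u'\to u}\frac{\varphi(\bar x+tu')-\varphi(\bar x)-t\langle x^*,u'\rangle}{\frac12t^2}$. *)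

(* Defs.v *)
From mathcomp Require Import all_boot all_order all_algebra.
From mathcomp Require Import all_classical all_reals all_analysis.

Set Implicit Arguments.
Unset Strict Implicit.
Unset Printing Implicit Defensive.

Import Order.TTheory GRing.Theory Num.Theory.
Import numFieldNormedType.Exports.

Local Open Scope classical_set_scope.
Local Open Scope ring_scope.

(* The library norm on row vectors is the sup norm, so the Euclidean structure
   of R^n is introduced here; the library topology on row vectors is the usual
   one and is used as is. *)
Definition dotv (R : realType) (n : nat) (u v : 'rV[R]_n) : R :=
  \sum_(i < n) u 0 i * v 0 i.

Definition enorm (R : realType) (n : nat) (u : 'rV[R]_n) : R :=
  Num.sqrt (dotv u u).

Definition unit_sphere (R : realType) (n : nat) : set 'rV[R]_n :=
  [set u | enorm u = 1].

Definition dir_nbhd (R : realType) (n : nat) (eps rho : R) (u : 'rV[R]_n) :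
    set 'rV[R]_n :=
  [set w | enorm w <= eps /\
    enorm (enorm w *: u - enorm u *: w) <= rho * enorm u * enorm w].

Definition strict_local_min_dir (R : realType) (n : nat)
    (phi : 'rV[R]_n -> \bar R) (xbar u : 'rV[R]_n) : Prop :=
  exists eps rho : R, [/\ 0 < eps, 0 < rho &
    forall x : 'rV[R]_n, dir_nbhd eps rho u (x - xbar) -> x != xbar ->
      (phi xbar < phi x)%E].

Definition strict_local_min (R : realType) (n : nat)
    (phi : 'rV[R]_n -> \bar R) (xbar : 'rV[R]_n) : Prop :=
  \forall x \near xbar, x != xbar -> (phi xbar < phi x)%E.

Definition growth_dir (R : realType) (n : nat)
    (phi : 'rV[R]_n -> \bar R) (xbar u : 'rV[R]_n) : Prop :=
  exists eps rho kappa : R, [/\ 0 < eps, 0 < rho, 0 < kappa &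
    forall x : 'rV[R]_n, dir_nbhd eps rho u (x - xbar) ->
      (phi xbar + (kappa * enorm (x - xbar) ^+ 2)%R%:E <= phi x)%E].

Definition growth (R : realType) (n : nat)
    (phi : 'rV[R]_n -> \bar R) (xbar : 'rV[R]_n) : Prop :=
  growth_dir phi xbar 0.

(* The lower limits below are taken along t -> 0 with t > 0 and u' -> u
   jointly, the value u' = u being allowed. *)
Definition subderivative (R : realType) (n : nat)
    (phi : 'rV[R]_n -> \bar R) (xbar u : 'rV[R]_n) : \bar R :=
  limf_einf
    (fun p : R * 'rV[R]_n =>
       ((phi (xbar + p.1 *: p.2)%R - phi xbar) * (p.1^-1)%R%:E)%E)
    (filter_prod 0^'+ (nbhs u)).

Definition critical_cone (R : realType) (n : nat)
    (phi : 'rV[R]_n -> \bar R) (xbar : 'rV[R]_n) : set 'rV[R]_n :=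
  [set u | (subderivative phi xbar u <= 0)%E].

Definition second_subderivative (R : realType) (n : nat)
    (phi : 'rV[R]_n -> \bar R) (xbar xstar u : 'rV[R]_n) : \bar R :=
  limf_einf
    (fun p : R * 'rV[R]_n =>
       ((phi (xbar + p.1 *: p.2)%R - phi xbar - (p.1 * dotv xstar p.2)%R%:E)
        * ((2^-1 * p.1 ^+ 2)^-1)%R%:E)%E)
    (filter_prod 0^'+ (nbhs u)).

(* Main.v *)
Require Import Defs.
From mathcomp Require Import all_boot all_order all_algebra.
From mathcomp Require Import all_classical all_reals all_analysis.
Import Order.TTheory GRing.Theory Num.Theory.
Import numFieldNormedType.Exports.
Local Open Scope classical_set_scope.
Local Open Scope ring_scope.

(** A positive lower limit bounds the difference quotients below by some [c > 0]
    for all small [t > 0] and all directions near [u].  For the second-order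
    quotient this says [phi (xbar + t v) >= phi xbar + (c / 2) t^2]; for the
    first-order one it says [phi (xbar + t v) >= phi xbar + c t], which is
    stronger, since [t^2 <= t] for [t <= 1].  Hence around every unit vector [u]
    with a positive second subderivative, and also around every unit vector
    outside the critical cone, there is quadratic growth along the rays of
    nearby directions, with a common step bound and a common constant
    ([ray_growth_second_subderivative], [ray_growth_subderivative]).

    Writing [x - xbar] in polar form turns this into growth at points
    ([ray_growth_polar]).  For a single [u] the directions concerned are those
    of the directional neighborhood, which gives the directional statement
    ([ray_growth_growth_dir]).  Under the hypothesis of the global statement,
    every unit vector falls under one of the two cases, and compactness of the
    Euclidean unit sphere makes the bounds uniform ([ray_growth_growth]).
    Strict minimality follows because the growth term is positive away from
    [xbar] and [phi xbar] is finite. *)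

Section euclidean_norm.
Context {R : realType} {n : nat}.
Implicit Types u v : 'rV[R]_n.

Lemma dot0v u : dotv 0 u = 0.
Proof. by rewrite /dotv big1// => i _; rewrite mxE mul0r. Qed.

Lemma enorm_ge0 u : 0 <= enorm u.
Proof. exact: sqrtr_ge0. Qed.

Lemma enorm0 : enorm (0 : 'rV[R]_n) = 0.
Proof. by rewrite /enorm dot0v sqrtr0. Qed.

Lemma enormZ (a : R) u : enorm (a *: u) = `|a| * enorm u.
Proof.
rewrite /enorm -sqrtr_sqr -sqrtrM ?sqr_ge0//; congr Num.sqrt.
by rewrite /dotv mulr_sumr; apply: eq_bigr => i _; rewrite !mxE mulrACA.
Qed.

(** The ambient topology comes from the sup norm; this comparison and
    [continuous_enorm] are what links it to Euclidean balls. *)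
Lemma mx_norm_le_enorm u : `|u| <= enorm u.
Proof.
have -> : `|u| = mx_norm u by [].
rewrite mx_normrE; apply: bigmax_le; first exact: enorm_ge0.
move=> [i j] _ /=; rewrite ord1 -sqrtr_sqr ler_wsqrtr//.
rewrite /dotv (bigD1 j)//= -expr2 lerDl.
by apply: sumr_ge0 => k _; rewrite -expr2 sqr_ge0.
Qed.

Lemma enorm_gt0 u : (0 < enorm u) = (u != 0).
Proof.
apply/idP/idP => [|u0]; first by apply: contraTneq => ->; rewrite enorm0 ltxx.
by apply: lt_le_trans (mx_norm_le_enorm u); rewrite normr_gt0.
Qed.

Lemma continuous_enorm : continuous (@enorm R n).
Proof.
have dotvv_continuous : continuous (fun u => dotv u u).
  apply: continuous_big => [|i _ u]; first exact: add_continuous.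
  have cu := @coord_continuous R 1 n 0 i u; exact: (cvgM cu cu).
move=> u; apply: (@continuous_comp _ _ _ (fun u => dotv u u) Num.sqrt).
  exact: dotvv_continuous.
exact: sqrt_continuous.
Qed.

Lemma compact_unit_sphere : compact (@unit_sphere R n).
Proof.
apply: bounded_closed_compact.
  exists 1; split=> // M M1 u u1; apply: le_trans (mx_norm_le_enorm u) _.
  by rewrite u1 ltW.
apply: (@preimage_closed _ _ (@enorm R n) [set 1]); last exact: closed_eq.
by move=> u _; exact: continuous_enorm.
Qed.

End euclidean_norm.

(** The lower limit is the supremum over the filter of the infima, so one of
    these infima is positive. When it is [+oo], [c = 1] is good enough. *)
Lemma limf_einf_gt0 (T : choiceType) (X : filteredType T) (R : realType)
    (f : X -> \bar R) (F : set_system X) (FF : Filter F) :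
  (0 < limf_einf f F)%E ->
  exists2 c : R, 0 < c & \forall x \near F, (c%:E <= f x)%E.
Proof.
rewrite limf_einfE => /ereal_sup_gt[_ [V FV <-]] V0.
have [c c0 cV] : exists2 c : R, 0 < c & (c%:E <= ereal_inf (f @` V))%E.
  case: (ereal_inf _) V0 => [r||//].
  - by rewrite lte_fin => r0; exists r.
  - by exists 1 => //; rewrite leey.
exists c => //; apply: filterS FV => x Vx.
by apply: le_trans cV _; apply: ereal_inf_lbound; exists x.
Qed.

(** The single parameter [s] bounds the step length and is the growth constant
    as well. A condition that holds for all small [s] then carries both
    existential constants along one filter, the form in which compactness of
    the sphere is applied. *)
Definition ray_growth {R : realType} {n : nat} (phi : 'rV[R]_n -> \bar R)
    (xbar : 'rV[R]_n) (s : R) (v : 'rV[R]_n) : Prop :=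
  forall t, 0 < t < s ->
    (phi xbar + (s * t ^+ 2)%:E <= phi (xbar + t *: v)%R)%E.

Section ray_growth.
Context {R : realType} {n : nat} (phi : 'rV[R]_n -> \bar R) (xbar : 'rV[R]_n).
Context (phi_fin : phi xbar \is a fin_num).

(** Any [s] below both the constant [c] and the radius of the neighborhood of
    [0] in which the estimate holds will do. *)
Lemma near_ray_growth {c : R} {u : 'rV[R]_n} : 0 < c ->
  (\forall p \near filter_prod 0^'+ (nbhs u),
    (phi xbar + (c * p.1 ^+ 2)%R%:E <= phi (xbar + p.1 *: p.2)%R)%E) ->
  \forall v \near u & s \near 0^'+, ray_growth phi xbar s v.
Proof.
move=> c0 [[A B]/= [[d /= d0 dA] uB] AB].
exists (B, [set s | 0 < s < Num.min c d]) => /=.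
  split=> //; near=> s; apply/andP; split; near: s; first exact: nbhs_right_gt.
  by apply: nbhs_right_lt; rewrite lt_min c0.
move=> [v s] /= [Bv /andP[s0]]; rewrite lt_min => /andP[sc sd] t /andP[t0 ts].
apply: (@le_trans _ _ (phi xbar + (c * t ^+ 2)%:E)%E).
  by rewrite leeD2l// lee_fin ler_wpM2r ?sqr_ge0// ltW.
apply: (AB (t, v)); split => //=; apply: dA => //=.
by rewrite sub0r normrN gtr0_norm// (lt_trans ts).
Unshelve. all: by end_near. Qed.

Lemma quotient_ge_growth {c k : R} {y : \bar R} : 0 < k ->
  (c%:E <= (y - phi xbar) * (k^-1)%:E)%E -> (phi xbar + (c * k)%:E <= y)%E.
Proof.
by move=> k0; rewrite lee_pdivlMr// EFinM leeBrDr// addeC.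
Qed.

(** Linear growth dominates quadratic growth for steps of length below [1], so
    positive first subderivatives yield quadratic growth as well. *)
Lemma ray_growth_subderivative (u : 'rV[R]_n) :
  (0 < subderivative phi xbar u)%E ->
  \forall v \near u & s \near 0^'+, ray_growth phi xbar s v.
Proof.
move=> /limf_einf_gt0[c c0 Hc]; apply: (near_ray_growth c0).
have : \forall p \near filter_prod 0^'+ (nbhs u), 0 < (p : R * 'rV[R]_n).1 < 1.
  exists ([set t | 0 < t < 1], setT) => /=; last by move=> [t v] [].
  split; last exact: filterT.
  by near=> t; apply/andP; split; near: t;
    [exact: nbhs_right_gt|exact: nbhs_right_lt].
apply: filterS2 Hc => -[t v] /= Hc /andP[t0 t1].
apply: le_trans (quotient_ge_growth t0 Hc).
by rewrite leeD2l// lee_fin ler_wpM2l ?(ltW c0)// expr2 ler_piMl// ltW.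
Unshelve. all: by end_near. Qed.

Lemma ray_growth_second_subderivative (u : 'rV[R]_n) :
  (0 < second_subderivative phi xbar 0 u)%E ->
  \forall v \near u & s \near 0^'+, ray_growth phi xbar s v.
Proof.
move=> /limf_einf_gt0[c c0 Hc].
apply: (@near_ray_growth (c / 2)); first by rewrite divr_gt0.
have : \forall p \near filter_prod 0^'+ (nbhs u), 0 < (p : R * 'rV[R]_n).1.
  exists ([set t | 0 < t], setT) => /=; last by move=> [t v] [].
  by split; [exact: nbhs_right_gt|exact: filterT].
apply: filterS2 Hc => -[t v] /=; rewrite dot0v mulr0 sube0 => Hc t0.
by rewrite -mulrA quotient_ge_growth// mulr_gt0// exprn_gt0.
Qed.

(** The ray through [x] is the one in the normalized direction of [x - xbar],
    reached at [t = enorm (x - xbar)]; at [x = xbar], where no direction exists,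
    the estimate is trivial. *)
Lemma ray_growth_polar (s : R) (x : 'rV[R]_n) :
  enorm (x - xbar) < s ->
  (x != xbar -> ray_growth phi xbar s ((enorm (x - xbar))^-1 *: (x - xbar))) ->
  (phi xbar + (s * enorm (x - xbar) ^+ 2)%:E <= phi x)%E.
Proof.
move=> xs; have [-> _|xx /(_ isT) H] := eqVneq x xbar.
  by rewrite subrr enorm0 expr0n mulr0 adde0.
have t0 : 0 < enorm (x - xbar) by rewrite enorm_gt0 subr_eq0.
have := H (enorm (x - xbar)); rewrite t0 xs => /(_ isT).
by rewrite scalerA divff ?gt_eqF// scale1r subrKC.
Qed.

Lemma growth_gt {k : R} {x : 'rV[R]_n} : 0 < k -> x != xbar ->
  (phi xbar + (k * enorm (x - xbar) ^+ 2)%:E <= phi x)%E ->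
  (phi xbar < phi x)%E.
Proof.
move=> k0 xx; apply: lt_le_trans.
by rewrite lteDl// lte_fin mulr_gt0// exprn_gt0// enorm_gt0 subr_eq0.
Qed.

Lemma growth_dir_strict_local_min_dir (u : 'rV[R]_n) :
  growth_dir phi xbar u -> strict_local_min_dir phi xbar u.
Proof.
move=> [e [r [k [e0 r0 k0 H]]]]; exists e, r; split=> // x xu xx.
exact: growth_gt k0 xx (H x xu).
Qed.

Lemma dir_nbhd0 (eps rho : R) (w : 'rV[R]_n) :
  dir_nbhd eps rho 0 w <-> enorm w <= eps.
Proof.
rewrite /dir_nbhd /= scaler0 enorm0 scale0r subrr enorm0 mulr0 mul0r lexx.
by split=> [[]|].
Qed.

Lemma growth_strict_local_min : growth phi xbar -> strict_local_min phi xbar.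
Proof.
move=> [e [r [k [e0 r0 k0 H]]]].
have : \forall x \near xbar, enorm (x - xbar) < e.
  have cB : (fun x => x - xbar) @ xbar --> xbar - xbar.
    exact: (@cvgB R _ _ (nbhs xbar) _ id (cst xbar) _ _ cvg_id (cvg_cst _)).
  have /cvgr_lt := cvg_comp _ _ cB (@continuous_enorm R n (xbar - xbar)).
  by apply; rewrite subrr enorm0.
apply: filterS => x xe xx; apply: growth_gt k0 xx (H x _).
by apply/dir_nbhd0; exact: ltW.
Qed.

(** For a unit vector [u], dividing by [enorm w] turns the second condition of
    [dir_nbhd eps rho u w] into the bound [rho] on the Euclidean distance from
    [u] to the normalized direction of [w]. *)
Lemma ray_growth_growth_dir (u : 'rV[R]_n) : unit_sphere u ->
  (\forall v \near u & s \near 0^'+, ray_growth phi xbar s v) ->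
  growth_dir phi xbar u.
Proof.
move=> u1 [[B S] /= [/nbhs_ballP[r /= r0 rB] S0] BS].
have [s s0 Ss] : exists2 s, 0 < s & S s.
  near (0 : R)^'+ => s; exists s; first by near: s; exact: nbhs_right_gt.
  by near: s.
(* Directional neighborhoods are closed, while [ray_growth] and balls are
   given by strict inequalities: halving [s] and [r] absorbs the difference. *)
exists (s / 2), (r / 2), s; split; rewrite ?divr_gt0// => x [xs].
rewrite u1 scale1r mulr1 => xu.
apply: ray_growth_polar.
  by apply: le_lt_trans xs _; rewrite ltr_pdivrMr// ltr_pMr// ltr1n.
move=> xx; apply: (BS (_, s)); split=> //=; apply: rB.
rewrite -ball_normE /=.
have t0 : 0 < enorm (x - xbar) by rewrite enorm_gt0 subr_eq0.
apply: le_lt_trans (mx_norm_le_enorm _) _.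
rewrite -(@ltr_pM2l _ (enorm (x - xbar)))// -[X in X * enorm _]gtr0_norm//.
rewrite -enormZ scalerBr scalerA divff ?gt_eqF// scale1r.
apply: le_lt_trans xu _.
by rewrite mulrC ltr_pM2l// ltr_pdivrMr// ltr_pMr// ltr1n.
Unshelve. all: by end_near. Qed.

(** Compactness, in its near-covering form, exchanges the quantifiers: one [s]
    serves every direction of the sphere. *)
Lemma ray_growth_growth :
  (forall u : 'rV[R]_n, unit_sphere u ->
    \forall v \near u & s \near 0^'+, ray_growth phi xbar s v) ->
  growth phi xbar.
Proof.
move=> H.
have /compact_near_coveringP := @compact_unit_sphere R n.
move=> /(_ R 0^'+ (ray_growth phi xbar) _ H) S0.
near (0 : R)^'+ => s.
have s0 : 0 < s by near: s; exact: nbhs_right_gt.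
have Ss : @unit_sphere R n `<=` ray_growth phi xbar s by near: s.
exists (s / 2), 1, s; split; rewrite ?divr_gt0// => x /dir_nbhd0 xs.
apply: ray_growth_polar.
  by apply: le_lt_trans xs _; rewrite ltr_pdivrMr// ltr_pMr// ltr1n.
move=> xx; apply: Ss; rewrite /unit_sphere /= enormZ.
have t0 : 0 < enorm (x - xbar) by rewrite enorm_gt0 subr_eq0.
by rewrite gtr0_norm ?invr_gt0// mulVf// gt_eqF.
Unshelve. all: by end_near. Qed.

End ray_growth.

Theorem proposition3p16 (R : realType) (n : nat) (phi : 'rV[R]_n -> \bar R)
    (phi_lsc : lower_semicontinuous phi) (xbar : 'rV[R]_n)
    (phi_fin : (`|phi xbar| < +oo)%E) :
  (forall u : 'rV[R]_n, (critical_cone phi xbar `&` @unit_sphere R n) u ->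
     (0 < second_subderivative phi xbar 0 u)%E ->
     growth_dir phi xbar u /\ strict_local_min_dir phi xbar u) /\
  ((forall u : 'rV[R]_n, (critical_cone phi xbar `&` @unit_sphere R n) u ->
      (0 < second_subderivative phi xbar 0 u)%E) ->
   growth phi xbar /\ strict_local_min phi xbar).
Proof.
have {}phi_fin : phi xbar \is a fin_num by rewrite fin_num_abs.
split=> [u [_ u1] d2u|d2].
  have gu : growth_dir phi xbar u.
    apply: ray_growth_growth_dir => //.
    exact: ray_growth_second_subderivative.
  by split=> //; exact: growth_dir_strict_local_min_dir gu.
suff g : growth phi xbar by split=> //; exact: growth_strict_local_min.
apply: ray_growth_growth => // u u1.
have [cu|du] := leP (subderivative phi xbar u) 0%E.
  exact/ray_growth_second_subderivative/d2.
exact: ray_growth_subderivative.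
Qed.
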